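(* Let $E$ be a Banach sequence lattice on a non-empty set $I$, let $(A_i)_{i\in I}$ be a family of Banach algebras, and let $A:=\bigl(\bigoplus_{i\in I}A_i\bigr)_{E}$ be their $E$-sum. Assume that $A$ has a bounded right approximate identity $(e_\alpha)_\alpha$ (i.e. a bounded net with $\|a-ae_\alpha\|\to0$ for every $a\in A$), and put $M:=\sup_\alpha\|e_\alpha\|<\infty$. Let $J:=\{j\in I: A_j\neq\{0\}\}$. Then $$\sup\bigl\{\|\chi_F\|_E:\ F\subseteq J,\ F \text{ finite}\bigr\}=C_{E|J}\le M<\infty.$$ In particular, if $A$ is amenable then $C_{E|J}<\infty$; and if moreover $A_i\neq\{0\}$ for all $i\in I$, then $C_E\le M<\infty$.
   Context: All Banach spaces and algebras are complex. $c_{00}(I)$ denotes the finitely supported complex functions on $I$, and $\chi_F$ the characteristic function of $F\subseteq I$. Banach sequence lattice. A Banach sequence lattice on $I$ is a Banach space $E$ of complex-valued functions on $I$ such that (a) $c_{00}(I)\subseteq E\subseteq\ell_\infty(I)$ and $c_{00}(I)$ is dense in $E$; (b) $E$ is solid: if $y\in E$, $x\in\ell_\infty(I)$ and $|x_i|\le|y_i|$ for all $i$, then $x\in E$ and $\|x\|_E\le\|y\|_E$; (c) $\|x\|_\infty\le\|x\|_E$ for all $x\in E$. Put $C_E:=\sup\{\|\chi_F\|_E: F\subseteq I\text{ finite}\}$. Restriction. For $J\subseteq I$, $E|J:=\{x|_J: x\in E\}$ with norm $\|u\|_{E|J}:=\inf\{\|x\|_E: x\in E,\ x|_J=u\}$;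 it is a Banach sequence lattice on $J$, and $C_{E|J}:=\sup\{\|\chi_F\|_{E|J}: F\subseteq J\text{ finite}\}$. $E$-sum. $\bigl(\bigoplus_{i\in I}A_i\bigr)_E$ is the Banach algebra of all families $a=(a_i)_{i\in I}$, $a_i\in A_i$, with $(\|a_i\|)_{i\in I}\in E$, with norm $\|a\|=\|(\|a_i\|)_{i\in I}\|_E$ and coordinatewise multiplication. Amenable means Johnson amenable: there is $M\in(A\widehat{\otimes}A)^{**}$ (a virtual diagonal) with $a\cdot M=M\cdot a$ and $a\cdot\pi^{**}(M)=a=\pi^{**}(M)\cdot a$ for all $a\in A$, where $\pi(a\otimes b)=ab$, $a\cdot(x\otimes y)=(ax)\otimes y$, $(x\otimes y)\cdot a=x\otimes(ya)$. *)

(* Defs.v *)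
From HB Require Import structures.
From mathcomp Require Import all_boot all_order all_algebra.
From mathcomp Require Import complex.
From mathcomp Require Import all_classical all_reals all_analysis.

Set Implicit Arguments.
Unset Strict Implicit.
Unset Printing Implicit Defensive.

Import Order.TTheory GRing.Theory Num.Theory.
Import numFieldNormedType.Exports.

Local Open Scope classical_set_scope.
Local Open Scope ring_scope.
Local Open Scope complex_scope.

(* In a normed module over R[i] the library norm `|x| is R[i]-valued; [rnorm x]
   is the same number seen as an element of R. *)
Definition rnorm (R : realType) (V : normedModType R[i]) (x : V) : R :=
  complex.Re `|x|.

Section rnorm_theory.
Variables (R : realType) (V : normedModType R[i]).
Implicit Types x y : V.

Lemma rnormE x : (rnorm x)%:C = `|x|.
Proof. by rewrite /rnorm RRe_real// normr_real. Qed.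

Lemma rnorm_ge0 x : 0 <= rnorm x.
Proof. by rewrite -ler0c rnormE. Qed.

Lemma rnorm0 : rnorm (0 : V) = 0.
Proof. by rewrite /rnorm normr0. Qed.

Lemma ler_rnormD x y : rnorm (x + y) <= rnorm x + rnorm y.
Proof. by rewrite -lecR rmorphD /= !rnormE ler_normD. Qed.

Lemma rnormZ (a : R[i]) x : rnorm (a *: x) = complex.Re `|a| * rnorm x.
Proof.
by apply: complexI; rewrite rmorphM/= !rnormE normrZ.
Qed.

Lemma rnorm_le x y : (rnorm x <= rnorm y) = (`|x| <= `|y|).
Proof. by rewrite -lecR !rnormE. Qed.

Lemma rnorm0_eq0 x : rnorm x = 0 -> x = 0.
Proof. by move=> x0; apply/normr0_eq0; rewrite -rnormE x0. Qed.

End rnorm_theory.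

(* Not necessarily unital, and possibly zero. *)
HB.mixin Record CompleteNormedModule_isBanachAlgebra (K : numFieldType) A
    & CompleteNormedModule K A := {
  bmul : A -> A -> A;
  bmulA : associative bmul;
  bmulDl : left_distributive bmul +%R;
  bmulDr : right_distributive bmul +%R;
  bmulZl : forall (k : K) x y, bmul (k *: x) y = k *: bmul x y;
  bmulZr : forall (k : K) x y, bmul x (k *: y) = k *: bmul x y;
  normr_bmul : forall x y, `|bmul x y| <= `|x| * `|y| }.

#[short(type="banachAlgType")]
HB.structure Definition BanachAlgebra (K : numFieldType) :=
  {A of CompleteNormedModule K A & CompleteNormedModule_isBanachAlgebra K A}.

Notation "x ** y" := (bmul x y) (at level 40, left associativity) : ring_scope.

Definition bounded_linear (R : realType) (V W : normedModType R[i])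
  (f : V -> W) := linear f /\ exists C : R, forall x, rnorm (f x) <= C * rnorm x.

Record blin (R : realType) (V W : normedModType R[i]) := Blin {
  blin_fun :> V -> W;
  blinP : bounded_linear blin_fun }.

Section blin_lmod.
Variables (R : realType) (V W : normedModType R[i]).
Local Notation C := R[i].
Implicit Types f g : blin V W.

Lemma blin_eq f g : f =1 g -> f = g.
Proof.
move: f g => [f fP] [g gP] /= /funext fg.
by subst g; congr Blin; exact: Prop_irrelevance.
Qed.

HB.instance Definition _ := gen_eqMixin (blin V W).
HB.instance Definition _ := gen_choiceMixin (blin V W).

Lemma blinD f x y : f (x + y) = f x + f y.
Proof. by have [+ _] := blinP f => /(_ 1 x y); rewrite !scale1r. Qed.

Lemma blin0 f : f 0 = 0.
Proof. by apply: (addIr (f 0)); rewrite -blinD !add0r. Qed.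

Lemma blinZ f (a : C) x : f (a *: x) = a *: f x.
Proof. by have [/(_ a x 0)] := blinP f; rewrite blin0 !addr0. Qed.

Lemma bounded_linear0 : bounded_linear (fun _ : V => 0 : W).
Proof.
split; first by move=> a x y; rewrite scaler0 addr0.
by exists 0 => x; rewrite rnorm0 mul0r.
Qed.

Lemma bounded_linearD f g : bounded_linear (fun x => f x + g x).
Proof.
split.
  by move=> a x y; rewrite !blinD !blinZ scalerDr addrACA.
have [[_ [M Mf]] [_ [N Ng]]] := (blinP f, blinP g).
exists (M + N) => x; rewrite (le_trans (ler_rnormD _ _))// mulrDl.
exact: lerD.
Qed.

Lemma bounded_linearZ (k : C) f : bounded_linear (fun x => k *: f x).
Proof.
split.
  by move=> a x y; rewrite blinD blinZ scalerDr !scalerA mulrC.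
have [_ [M Mf]] := blinP f.
exists (complex.Re `|k| * M) => x; rewrite rnormZ -mulrA ler_wpM2l//.
exact: (rnorm_ge0 (k : C^o)).
Qed.

Definition blin_zero := Blin bounded_linear0.
Definition blin_add f g := Blin (bounded_linearD f g).
Definition blin_scale (k : C) f := Blin (bounded_linearZ k f).
Definition blin_opp f := blin_scale (-1) f.

Lemma blin_addA : associative blin_add.
Proof. by move=> f g h; apply: blin_eq => x /=; rewrite addrA. Qed.
Lemma blin_addC : commutative blin_add.
Proof. by move=> f g; apply: blin_eq => x /=; rewrite addrC. Qed.
Lemma blin_add0 : left_id blin_zero blin_add.
Proof. by move=> f; apply: blin_eq => x /=; rewrite add0r. Qed.
Lemma blin_addN : left_inverse blin_zero blin_opp blin_add.
Proof. by move=> f; apply: blin_eq => x /=; rewrite scaleN1r addNr. Qed.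

HB.instance Definition _ :=
  GRing.isZmodule.Build (blin V W) blin_addA blin_addC blin_add0 blin_addN.

Lemma blin_scaleA a b f : blin_scale a (blin_scale b f) = blin_scale (a * b) f.
Proof. by apply: blin_eq => x /=; rewrite scalerA. Qed.
Lemma blin_scale1 : left_id 1 blin_scale.
Proof. by move=> f; apply: blin_eq => x /=; rewrite scale1r. Qed.
Lemma blin_scaleDr : right_distributive blin_scale +%R.
Proof. by move=> a f g; apply: blin_eq => x /=; rewrite scalerDr. Qed.
Lemma blin_scaleDl f : {morph blin_scale^~ f : a b / a + b}.
Proof. by move=> a b; apply: blin_eq => x /=; rewrite scalerDl. Qed.

HB.instance Definition _ := GRing.Zmodule_isLmodule.Build C (blin V W)
  blin_scaleA blin_scale1 blin_scaleDr blin_scaleDl.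

Definition op_norm f : R := sup [set rnorm (f x) | x in [set x | rnorm x <= 1]].

Lemma op_norm_has_sup f :
  has_sup [set rnorm (f x) | x in [set x | rnorm x <= 1]].
Proof.
split; first by exists (rnorm (f 0)), 0 => //=; rewrite rnorm0.
have [_ [M Mf]] := blinP f; exists `|M| => _ [x /= x1 <-].
rewrite (le_trans (Mf x))// (le_trans (ler_norm _))// normrM ler_piMr//.
by rewrite ger0_norm// rnorm_ge0.
Qed.

Lemma op_norm_ge0 f : 0 <= op_norm f.
Proof.
rewrite /op_norm (le_trans (rnorm_ge0 (f 0)))//.
apply: (sup_upper_bound (op_norm_has_sup f)).
by exists 0 => //=; rewrite rnorm0.
Qed.

Lemma rnorm_blin f x : rnorm (f x) <= op_norm f * rnorm x.
Proof.
have [->|x0] := eqVneq x 0; first by rewrite blin0 !rnorm0 mulr0.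
have nx0 : 0 < rnorm x.
  rewrite lt_neqAle rnorm_ge0 andbT eq_sym.
  by apply: contra_neq x0 => /rnorm0_eq0.
rewrite -ler_pdivrMr//.
have nE : complex.Re `|((rnorm x)^-1)%:C| = (rnorm x)^-1.
  by rewrite ger0_norm// lecR invr_ge0 ltW.
have -> : rnorm (f x) / rnorm x = rnorm (f (((rnorm x)^-1)%:C *: x)).
  by rewrite blinZ rnormZ nE mulrC.
apply: (sup_upper_bound (op_norm_has_sup f)).
by exists (((rnorm x)^-1)%:C *: x) => //=; rewrite rnormZ nE mulVf// gt_eqF.
Qed.

Lemma op_norm_le f (M : R) : 0 <= M ->
  (forall x, rnorm (f x) <= M * rnorm x) -> op_norm f <= M.
Proof.
move=> M0 Mf; apply: ge_sup; first by case: (op_norm_has_sup f).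
by move=> _ [x /= x1 <-]; rewrite (le_trans (Mf x))// ler_piMr.
Qed.

Definition op_normC f : C := (op_norm f)%:C.

Lemma op_normCD f g : op_normC (f + g) <= op_normC f + op_normC g.
Proof.
rewrite -rmorphD/= lecR; apply: op_norm_le; first by rewrite addr_ge0 ?op_norm_ge0.
move=> x; rewrite (le_trans (ler_rnormD _ _))// mulrDl.
by rewrite lerD// rnorm_blin.
Qed.

Lemma op_norm_scale_le (k : C) f : op_norm (k *: f) <= complex.Re `|k| * op_norm f.
Proof.
have k0 : 0 <= complex.Re `|k| := rnorm_ge0 (k : C^o).
apply: op_norm_le; first by rewrite mulr_ge0 ?op_norm_ge0.
by move=> x; rewrite [X in rnorm X]/= rnormZ -mulrA ler_wpM2l// rnorm_blin.
Qed.

Lemma op_normCZ (k : C) f : op_normC (k *: f) = `|k| * op_normC f.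
Proof.
have kE : `|k| = (complex.Re `|k|)%:C by rewrite (rnormE (k : C^o)).
rewrite kE -rmorphM /op_normC; congr (_%:C); apply/le_anti.
rewrite op_norm_scale_le andTb.
have [->|k0] := eqVneq k 0.
  by rewrite normr0 mul0r op_norm_ge0.
have nk0 : 0 < complex.Re `|k| by rewrite -ltcR -kE normr_gt0.
rewrite -ler_pdivlMl// -[in leLHS](scalerK k0 f).
rewrite (le_trans (op_norm_scale_le _ _))// normrV ?unitfE//.
by rewrite kE -fmorphV.
Qed.

Lemma op_normC_eq0 f : op_normC f = 0 -> f = 0.
Proof.
move=> /complexI f0; apply: blin_eq => x; apply: rnorm0_eq0; apply/le_anti.
by rewrite rnorm_ge0 (le_trans (rnorm_blin _ _))// f0 mul0r.
Qed.

HB.instance Definition _ := Lmodule_isNormed.Build C (blin V W)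
  op_normCD op_normCZ op_normC_eq0.

End blin_lmod.

Definition dual (R : realType) (V : normedModType R[i]) := blin V (R[i])^o.
Definition bidual (R : realType) (V : normedModType R[i]) := dual (dual V).

Lemma rnorm_blinE (R : realType) (V W : normedModType R[i]) (L : blin V W) :
  rnorm L = op_norm L.
Proof. by []. Qed.

Section adjoint.
Variables (R : realType) (V W : normedModType R[i]).

Lemma bounded_linear_comp (L : blin V W) (f : dual W) :
  bounded_linear (fun x => f (L x) : (R[i])^o).
Proof.
split; first by move=> a x y; rewrite !(blinD, blinZ).
exists (op_norm f * op_norm L) => x; rewrite -mulrA.
by rewrite (le_trans (rnorm_blin _ _))// ler_wpM2l ?op_norm_ge0// rnorm_blin.
Qed.

Lemma bounded_linear_adjoint (L : blin V W) :
  bounded_linear (fun f : dual W => Blin (bounded_linear_comp L f) : dual V).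
Proof.
split; first by move=> a f g; apply: blin_eq => x.
exists (op_norm L) => f; rewrite mulrC rnorm_blinE.
apply: op_norm_le; first by rewrite mulr_ge0 ?rnorm_ge0 ?op_norm_ge0.
move=> x /=; rewrite -mulrA (le_trans (rnorm_blin _ _))//.
by rewrite ler_wpM2l ?op_norm_ge0// rnorm_blin.
Qed.

Definition adjoint (L : blin V W) : blin (dual W) (dual V) :=
  Blin (bounded_linear_adjoint L).

Lemma bounded_linear_eval (x : V) :
  bounded_linear (fun f : dual V => f x : (R[i])^o).
Proof.
split; first by [].
by exists (rnorm x) => f; rewrite mulrC rnorm_blin.
Qed.

Definition bidual_embed (x : V) : bidual V := Blin (bounded_linear_eval x).

End adjoint.

Definition biadjoint (R : realType) (V W : normedModType R[i]) (L : blin V W) :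
  blin (bidual V) (bidual W) := adjoint (adjoint L).

Definition bounded_bilinear (R : realType) (V W Z : normedModType R[i])
    (C : R) (phi : V -> W -> Z) :=
  bilinear_for *:%R *:%R phi /\
  forall x y, rnorm (phi x y) <= C * rnorm x * rnorm y.

(* A projective tensor product of V and W: a Banach space with a contractive
   bilinear map through which every bounded bilinear map into a Banach space
   factors, uniquely and without increase of the norm. This determines it up
   to isometric isomorphism. *)
Record projTensor (R : realType) (V W : completeNormedModType R[i]) :=
  ProjTensor {
  pt_space :> completeNormedModType R[i];
  tens : V -> W -> pt_space;
  tensP : bounded_bilinear 1 tens;
  pt_univ : forall (Z : completeNormedModType R[i]) (phi : V -> W -> Z) (C : R),
    0 <= C -> bounded_bilinear C phi ->
    exists psi : blin pt_space Z,
      [/\ forall x y, psi (tens x y) = phi x y,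
          forall t, rnorm (psi t) <= C * rnorm t
        & forall psi' : blin pt_space Z,
            (forall x y, psi' (tens x y) = phi x y) -> psi' = psi] }.

Definition pt_lift (R : realType) (V W : completeNormedModType R[i])
    (T : projTensor V W) (Z : completeNormedModType R[i]) (phi : V -> W -> Z) :
    blin T Z :=
  xget 0 [set psi : blin T Z | forall x y, psi (tens T x y) = phi x y].

Lemma pt_liftE (R : realType) (V W : completeNormedModType R[i])
    (T : projTensor V W) (Z : completeNormedModType R[i]) (phi : V -> W -> Z)
    (C : R) : 0 <= C -> bounded_bilinear C phi ->
  forall x y, pt_lift T phi (tens T x y) = phi x y.
Proof.
move=> C0 phiP x y; rewrite /pt_lift; case: xgetP => [psi _ -> //|no].
by have [psi [psiP _ _]] := pt_univ T C0 phiP; case: (no psi).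
Qed.

Section amenability.
Variables (R : realType) (B : banachAlgType R[i]).
Implicit Types a b x y : B.

Lemma rnorm_bmul a b : rnorm (a ** b) <= rnorm a * rnorm b.
Proof. by rewrite -lecR rmorphM /= !rnormE normr_bmul. Qed.

Lemma bounded_linear_lmul a : bounded_linear (fun b : B => a ** b).
Proof.
split; first by move=> k b c; rewrite bmulDr bmulZr.
by exists (rnorm a) => b; exact: rnorm_bmul.
Qed.

Lemma bounded_linear_rmul a : bounded_linear (fun b : B => b ** a).
Proof.
split; first by move=> k b c; rewrite bmulDl bmulZl.
by exists (rnorm a) => b; rewrite mulrC rnorm_bmul.
Qed.

Definition lmul a : blin B B := Blin (bounded_linear_lmul a).
Definition rmul a : blin B B := Blin (bounded_linear_rmul a).

Variable T : projTensor B B.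

Definition pt_lact a : blin T T := pt_lift T (fun x y => tens T (a ** x) y).
Definition pt_ract a : blin T T := pt_lift T (fun x y => tens T x (y ** a)).
Definition pt_mul : blin T B := pt_lift T (fun x y => x ** y).

Lemma pt_lactE a x y : pt_lact a (tens T x y) = tens T (a ** x) y.
Proof.
have [[Tl Tr] Tn] := tensP T.
apply: (@pt_liftE _ _ _ T _ (fun x y => tens T (a ** x) y) _ (rnorm_ge0 a)).
split; first split.
- by move=> z k u v /=; rewrite bmulDr bmulZr Tl.
- by move=> z k u v /=; rewrite Tr.
- move=> u v; rewrite (le_trans (Tn _ _))// mul1r ler_wpM2r ?rnorm_ge0//.
  exact: rnorm_bmul.
Qed.

Lemma pt_ractE a x y : pt_ract a (tens T x y) = tens T x (y ** a).
Proof.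
have [[Tl Tr] Tn] := tensP T.
apply: (@pt_liftE _ _ _ T _ (fun x y => tens T x (y ** a)) _ (rnorm_ge0 a)).
split; first split.
- by move=> z k u v /=; rewrite Tl.
- by move=> z k u v /=; rewrite bmulDl bmulZl Tr.
- move=> u v; rewrite (le_trans (Tn _ _))// mul1r [rnorm a * _]mulrC -mulrA.
  by rewrite ler_wpM2l ?rnorm_ge0// mulrC rnorm_bmul.
Qed.

Lemma pt_mulE x y : pt_mul (tens T x y) = x ** y.
Proof.
apply: (@pt_liftE _ _ _ T _ (fun x y => x ** y) _ ler01); split; first split.
- by move=> z k u v /=; rewrite bmulDl bmulZl.
- by move=> z k u v /=; rewrite bmulDr bmulZr.
- by move=> u v; rewrite mul1r rnorm_bmul.
Qed.

(* For an element a of B, the bimodule actions of a on the biduals of T and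
   of B are the second adjoints of its actions on T and on B. *)
Definition virtual_diagonal (M : bidual T) :=
  forall a,
    [/\ biadjoint (pt_lact a) M = biadjoint (pt_ract a) M,
        biadjoint (lmul a) (biadjoint pt_mul M) = bidual_embed a
      & biadjoint (rmul a) (biadjoint pt_mul M) = bidual_embed a].

End amenability.

Definition amenable (R : realType) (B : banachAlgType R[i]) :=
  exists (T : projTensor B B) (M : bidual T), virtual_diagonal M.

Definition directed (D : Type) (le : D -> D -> Prop) :=
  [/\ inhabited D, forall x, le x x,
      forall x y z, le x y -> le y z -> le x z
    & forall x y, exists2 z, le x z & le y z].

Definition bounded_right_approx_id (R : realType) (B : banachAlgType R[i])
    (D : Type) (le : D -> D -> Prop) (e : D -> B) :=
  [/\ directed le, exists C : R, forall d, rnorm (e d) <= C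
    & forall (a : B) (eps : R), 0 < eps ->
        exists d0, forall d, le d0 d -> rnorm (a - a ** e d) < eps].

Section linf.
Variables (R : realType) (I : Type).
Implicit Type f : I -> R[i].

Definition linf_norm f : \bar R :=
  ereal_sup (range (fun i => (complex.Re `|f i|)%:E)).

Definition c00 : set (I -> R[i]) := [set f | finite_set [set i | f i != 0]].
Definition linfty : set (I -> R[i]) := [set f | (linf_norm f < +oo)%E].

End linf.

(* The elements of the Banach space [sl_space] are regarded as functions on I
   through the injective linear map [sl_fun]. *)
Record seqLattice (R : realType) (I : Type) := SeqLattice {
  sl_space :> completeNormedModType R[i];
  sl_fun : sl_space -> I -> R[i];
  sl_fun_inj : injective sl_fun;
  sl_fun_linear : forall (k : R[i]) x y i,
    sl_fun (k *: x + y) i = k * sl_fun x i + sl_fun y i;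
  sl_c00 : @c00 R I `<=` range sl_fun;
  sl_linfty : range sl_fun `<=` @linfty R I;
  sl_dense : dense (sl_fun @^-1` @c00 R I);
  sl_solid : forall y (f : I -> R[i]), linfty f ->
    (forall i, `|f i| <= `|sl_fun y i|) ->
    exists2 x, sl_fun x = f & rnorm x <= rnorm y;
  sl_linf_norm : forall x, (linf_norm (sl_fun x) <= (rnorm x)%:E)%E }.

Section lattice_norm.
Variables (R : realType) (I : Type) (E : seqLattice R I).
Implicit Type f : I -> R[i].

Definition in_sl f := range (@sl_fun R I E) f.

(* Meaningful only for f in E; the default value is 0. *)
Definition sl_elem f : E := xget 0 [set x | sl_fun x = f].

Definition sl_norm f : R := rnorm (sl_elem f).

(* The quotient norm of E|J; meaningful only for u in E|J. *)
Definition sl_restr_norm (J : set I) (u : J -> R[i]) : R :=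
  inf [set rnorm x | x in [set x : E | forall j : J, sl_fun x (\val j) = u j]].

End lattice_norm.

(* C_E is [lattice_const (sl_norm E)], and C_(E|J) is
   [lattice_const (@sl_restr_norm R I E J)]. *)
Definition lattice_const (R : realType) (I : Type) (N : (I -> R[i]) -> R) :
  \bar R := ereal_sup [set (N \1_F)%:E | F in [set F : set I | finite_set F]].

Section seqLattice_theory.
Variables (R : realType) (I : Type) (E : seqLattice R I).
Implicit Types (x y : E) (f : I -> R[i]).

Lemma sl_funD x y i : sl_fun (x + y) i = sl_fun x i + sl_fun y i.
Proof. by have := sl_fun_linear 1 x y i; rewrite scale1r mul1r. Qed.

Lemma sl_fun0 i : sl_fun (0 : E) i = 0.
Proof. by apply: (addIr (sl_fun (0 : E) i)); rewrite -sl_funD !add0r. Qed.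

Lemma sl_funZ (k : R[i]) x i : sl_fun (k *: x) i = k * sl_fun x i.
Proof. by have := sl_fun_linear k x 0 i; rewrite sl_fun0 !addr0. Qed.

Lemma sl_funB x y i : sl_fun (x - y) i = sl_fun x i - sl_fun y i.
Proof. by rewrite sl_funD -scaleN1r sl_funZ mulN1r. Qed.

Lemma Re_normc_le (a b : R[i]) :
  (complex.Re `|a| <= complex.Re `|b|) = (`|a| <= `|b|).
Proof. exact: (@rnorm_le R (R[i])^o). Qed.

Lemma le_linf_norm f i : ((complex.Re `|f i|)%:E <= linf_norm f)%E.
Proof. by apply: ereal_sup_ubound; exists i. Qed.

Lemma norm_sl_fun x i : `|sl_fun x i| <= `|x|.
Proof.
rewrite -(rnormE x) -(rnormE (sl_fun x i : (R[i])^o)) lecR -lee_fin.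
exact: (le_trans (le_linf_norm _ _) (sl_linf_norm _)).
Qed.

Lemma sl_solidW y f : (forall i, `|f i| <= `|sl_fun y i|) ->
  exists2 x : E, sl_fun x = f & `|x| <= `|y|.
Proof.
move=> fy; have [|x xf xy] := @sl_solid _ _ E y f _ fy.
  rewrite /linfty/= (@le_lt_trans _ _ (rnorm y)%:E) ?ltry//.
  apply: ge_ereal_sup => _ [i _ <-]; apply: le_trans (sl_linf_norm y).
  by apply: le_trans (le_linf_norm _ i); rewrite lee_fin Re_normc_le.
by exists x; rewrite -?rnorm_le.
Qed.

Lemma sl_elemK f : in_sl E f -> sl_fun (sl_elem E f) = f.
Proof.
move=> [x _ xf]; rewrite /sl_elem.
by case: xgetP => [y _ //|/(_ x)]; case.
Qed.

Lemma sl_funK x : sl_elem E (sl_fun x) = x.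
Proof. by apply: (@sl_fun_inj _ _ E _ _); apply: sl_elemK; exists x. Qed.

Lemma sl_elem_le f x : (forall i, `|f i| <= `|sl_fun x i|) ->
  in_sl E f /\ `|sl_elem E f| <= `|x|.
Proof.
move=> /sl_solidW[z zf zx]; split; first by exists z.
by rewrite -zf sl_funK.
Qed.

End seqLattice_theory.

Section geometric.
Variable R : realType.
Local Notation C := R[i].
Let q n : C := (2^-1) ^+ n.

Let q_gt0 n : 0 < q n.
Proof. by rewrite exprn_gt0// invr_gt0. Qed.

Let qS n : q n = q n.+1 *+ 2.
Proof. by rewrite /q exprS -mulrnAl -[_^-1 *+ 2]mulr_natr mulVf ?mul1r// pnatr_eq0. Qed.

Lemma geometric_small (e : C) : 0 < e -> exists n, q n *+ 16 < e.
Proof.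
move=> e0; have eE : (complex.Re e)%:C = e by rewrite RRe_real// gtr0_real.
have r0 : 0 < complex.Re e / 16 by rewrite divr_gt0// -ltcR eE.
have h : `|2^-1 : R| < 1 by rewrite ger0_norm// invf_lt1// ltr1n.
have /cvgrPdist_lt/(_ _ r0)[n _ /(_ n (leqnn n))] := cvg_expr h.
rewrite sub0r normrN ger0_norm ?exprn_ge0// ltr_pdivlMr// => qn.
exists n; rewrite -eE -mulr_natr.
have -> : q n * 16 = ((2^-1 : R) ^+ n * 16)%:C.
  by rewrite rmorphM rmorphXn fmorphV !rmorph_nat.
by rewrite ltcR.
Qed.

Lemma geometric_dist (V : normedModType C) (u : nat -> V) :
  (forall n, `|u n.+1 - u n| <= q n *+ 2) ->
  forall n k, `|u (n + k)%N - u n| <= q n *+ 4.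
Proof.
move=> uq n k; apply: (@le_trans _ _ (q n *+ 4 - q (n + k)%N *+ 4)); last first.
  by rewrite gerDl oppr_le0 mulrn_wge0// ltW.
elim: k => [|k IH]; first by rewrite addn0 !subrr normr0.
rewrite addnS (le_trans (ler_distD (u (n + k)%N) _ _))// addrC.
rewrite (le_trans (lerD IH (uq _)))// -addrA lerD2l [in leLHS]qS.
by rewrite -!mulrnA -[(2 * 4)%N]/(4 + 4)%N mulrnDr opprD -addrA addNr addr0.
Qed.

Lemma geometric_cvg (V : completeNormedModType C) (u : nat -> V) :
  (forall n, `|u n.+1 - u n| <= q n *+ 2) ->
  exists l, forall n, `|l - u n| <= q n *+ 8.
Proof.
move=> uq; have ud := geometric_dist uq.
have /cauchy_cvg /cvg_ex[l ul] : cauchy (u @ \oo).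
  apply: cauchy_exP => e /geometric_small[n ne].
  exists (u n); exists n => // m /= nm; rewrite -ball_normE /= distrC.
  rewrite -(subnKC nm) (le_lt_trans (ud _ _))// (le_lt_trans _ ne)//.
  by rewrite ler_wpMn2l// ltW.
exists l => n.
have q4 : 0 < q n *+ 4 by rewrite mulrn_wgt0.
have /cvgrPdist_lt/(_ _ q4)[m _ /(_ (n + m)%N (leq_addl _ _))] := ul.
move=> /ltW lm; rewrite (le_trans (ler_distD (u (n + m)%N) _ _))//.
by rewrite -[8%N]/(4 + 4)%N mulrnDr lerD.
Qed.

End geometric.

Record Esum (R : realType) (I : Type) (E : seqLattice R I)
    (A : I -> banachAlgType R[i]) := MkEsum {
  Esum_fun :> forall i, A i;
  EsumP : in_sl E (fun i => `|Esum_fun i|) }.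

Section Esum_theory.
Variables (R : realType) (I : Type) (E : seqLattice R I).
Variable (A : I -> banachAlgType R[i]).
Local Notation C := R[i].
Local Notation S := (Esum E A).
Implicit Types a b c : S.

Lemma Esum_eq a b : (forall i, a i = b i) -> a = b.
Proof.
move: a b => [a aP] [b bP] /= ab.
have {}ab : a = b by apply: functional_extensionality_dep.
by subst b; congr MkEsum; exact: Prop_irrelevance.
Qed.

HB.instance Definition _ := gen_eqMixin S.
HB.instance Definition _ := gen_choiceMixin S.

Definition Esum_norm_elem a : E := sl_elem E (fun i => `|a i|).

Lemma Esum_norm_elemE a i : sl_fun (Esum_norm_elem a) i = `|a i|.
Proof. by rewrite /Esum_norm_elem sl_elemK//; exact: EsumP. Qed.

Lemma in_Esum (x : E) (a : forall i, A i) :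
  (forall i, `|a i| <= `|sl_fun x i|) -> in_sl E (fun i => `|a i|).
Proof. by move=> ax; apply: (@sl_elem_le _ _ E _ x _).1 => i; rewrite normr_id. Qed.

Lemma Esum_zero_subproof : in_sl E (fun i => `|0 : A i|).
Proof. by apply: (@in_Esum 0) => i; rewrite normr0. Qed.

Lemma Esum_add_le a b i : `|a i + b i| <=
  `|sl_fun (Esum_norm_elem a + Esum_norm_elem b) i|.
Proof.
rewrite sl_funD !Esum_norm_elemE (ger0_norm (addr_ge0 _ _))//.
exact: ler_normD.
Qed.

Lemma Esum_scale_le (k : C) a i :
  `|k *: a i| <= `|sl_fun (k *: Esum_norm_elem a) i|.
Proof. by rewrite sl_funZ Esum_norm_elemE normrZ normrM normr_id. Qed.

Lemma Esum_mul_le a b i : `|a i ** b i| <=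
  `|sl_fun (`|Esum_norm_elem a| *: Esum_norm_elem b) i|.
Proof.
rewrite sl_funZ Esum_norm_elemE normrM !normr_id.
rewrite (le_trans (normr_bmul _ _))// ler_wpM2r//.
by rewrite -[`|a i|]normr_id -Esum_norm_elemE norm_sl_fun.
Qed.

Definition Esum_zero : S := MkEsum Esum_zero_subproof.
Definition Esum_add a b : S := 
  MkEsum (@in_Esum _ (fun i => a i + b i) (Esum_add_le a b)).
Definition Esum_scale k a : S := 
  MkEsum (@in_Esum _ (fun i => k *: a i) (Esum_scale_le k a)).
Definition Esum_mul a b : S := 
  MkEsum (@in_Esum _ (fun i => a i ** b i) (Esum_mul_le a b)).
Definition Esum_opp a := Esum_scale (-1) a.

Lemma Esum_addA : associative Esum_add.
Proof. by move=> a b c; apply: Esum_eq => i /=; rewrite addrA. Qed.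
Lemma Esum_addC : commutative Esum_add.
Proof. by move=> a b; apply: Esum_eq => i /=; rewrite addrC. Qed.
Lemma Esum_add0 : left_id Esum_zero Esum_add.
Proof. by move=> a; apply: Esum_eq => i /=; rewrite add0r. Qed.
Lemma Esum_addN : left_inverse Esum_zero Esum_opp Esum_add.
Proof. by move=> a; apply: Esum_eq => i /=; rewrite scaleN1r addNr. Qed.

HB.instance Definition _ :=
  GRing.isZmodule.Build S Esum_addA Esum_addC Esum_add0 Esum_addN.

Lemma Esum_scaleA k l a : Esum_scale k (Esum_scale l a) = Esum_scale (k * l) a.
Proof. by apply: Esum_eq => i /=; rewrite scalerA. Qed.
Lemma Esum_scale1 : left_id 1 Esum_scale.
Proof. by move=> a; apply: Esum_eq => i /=; rewrite scale1r. Qed.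
Lemma Esum_scaleDr : right_distributive Esum_scale +%R.
Proof. by move=> k a b; apply: Esum_eq => i /=; rewrite scalerDr. Qed.
Lemma Esum_scaleDl a : {morph Esum_scale^~ a : k l / k + l}.
Proof. by move=> k l; apply: Esum_eq => i /=; rewrite scalerDl. Qed.

HB.instance Definition _ := GRing.Zmodule_isLmodule.Build C S
  Esum_scaleA Esum_scale1 Esum_scaleDr Esum_scaleDl.

Lemma Esum_funB a b i : (a - b) i = a i - b i.
Proof. by rewrite /= scaleN1r. Qed.

Definition Esum_norm a : C := `|Esum_norm_elem a|.

Lemma Esum_norm_le a (x : E) :
  (forall i, `|a i| <= `|sl_fun x i|) -> Esum_norm a <= `|x|.
Proof. by move=> ax; apply: (@sl_elem_le _ _ E _ x _).2 => i; rewrite normr_id. Qed.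

Lemma Esum_normD a b : Esum_norm (a + b) <= Esum_norm a + Esum_norm b.
Proof.
by rewrite (le_trans (@Esum_norm_le (a + b) _ (Esum_add_le a b)))// ler_normD.
Qed.

Lemma Esum_normZ (k : C) a : Esum_norm (k *: a) = `|k| * Esum_norm a.
Proof.
rewrite /Esum_norm -[X in X * _]normr_id -normrZ; congr `| _ |.
apply: (@sl_fun_inj _ _ E _ _); apply/funext => i.
by rewrite sl_funZ !Esum_norm_elemE /= normrZ.
Qed.

Lemma Esum_norm_eq0 a : Esum_norm a = 0 -> a = 0.
Proof.
move=> a0; apply: Esum_eq => i; apply/normr0_eq0; rewrite -Esum_norm_elemE.
by rewrite (normr0_eq0 a0) sl_fun0.
Qed.

HB.instance Definition _ := Lmodule_isNormed.Build C S
  Esum_normD Esum_normZ Esum_norm_eq0.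

Lemma Esum_normE a : `|a| = `|Esum_norm_elem a|.
Proof. by []. Qed.

Lemma norm_Esum_fun a i : `|a i| <= `|a|.
Proof. by rewrite Esum_normE -[`|a i|]normr_id -Esum_norm_elemE norm_sl_fun. Qed.

Lemma Esum_complete (F : set_system S) : ProperFilter F -> cauchy F -> cvg F.
Proof.
move=> FF /cauchyP Fc; pose q n : C := (2^-1) ^+ n.
have q0 n : 0 < q n by rewrite exprn_gt0// invr_gt0.
have /choice[b Fb] n : exists b, F (ball b (q n)) by exact: Fc.
have bq n : `|b n.+1 - b n| <= q n *+ 2.
  have [c []] := filter_ex (filterI (Fb n) (Fb n.+1)).
  rewrite -!ball_normE /= => /ltW bc /ltW bc'.
  rewrite (le_trans (ler_distD c _ _))// [X in _ + X]distrC mulr2n lerD//.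
  by rewrite (le_trans bc')// ler_wiXn2l// ?invr_ge0// invf_le1// ler1n.
pose x n := Esum_norm_elem (b n.+1 - b n).
pose s n := \sum_(k < n) x k.
have [t ts] : exists t, forall n, `|t - s n| <= q n *+ 8.
  by apply: geometric_cvg => n; rewrite /s big_ord_recr/= addrAC subrr add0r; exact: bq.
have /all_sig[a ab] i : {ai : A i | forall n, `|ai - b n i| <= q n *+ 8}.
  apply: cid; apply: (@geometric_cvg _ (A i) (fun n => b n i)) => n.
  by rewrite -Esum_funB (le_trans (norm_Esum_fun _ _) (bq n)).
have bs n k i : `|b (n + k)%N i - b n i| <= sl_fun (s (n + k)%N - s n) i.
  rewrite sl_funB; elim: k => [|k IH]; first by rewrite addn0 !subrr normr0.
  rewrite addnS (le_trans (ler_distD (b (n + k)%N i) _ _))//.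
  rewrite [s (n + k).+1]big_ord_recr/= sl_funD addrAC addrC lerD//.
  by rewrite Esum_norm_elemE Esum_funB.
have as_ n i : `|a i - b n i| <= `|sl_fun (t - s n) i|.
  rewrite real_leNgt ?normr_real//; apply/negP; rewrite -subr_gt0.
  move=> /geometric_small[k]; rewrite -/(q k) => /lt_geF/negbT/negP; apply.
  rewrite lerBlDr.
  have qk : q (n + k)%N <= q k.
    by rewrite ler_wiXn2l ?leq_addl// ?invr_ge0// invf_le1// ler1n.
  rewrite (le_trans (ler_distD (b (n + k)%N i) _ _))//.
  rewrite -[16%N]/(8 + 8)%N mulrnDr -addrA lerD//.
    by rewrite (le_trans (ab _ _))// lerMn2r.
  rewrite (le_trans (bs _ _ _))// (le_trans (real_ler_norm _))//.
    by rewrite ger0_real// (le_trans _ (bs _ _ _)).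
  have -> : s (n + k)%N - s n = (t - s n) - (t - s (n + k)%N).
    by rewrite opprB [RHS]addrC addrA subrK.
  rewrite sl_funB (le_trans (ler_normB _ _))// [leRHS]addrC lerD2l.
  by rewrite (le_trans (norm_sl_fun _ _))// (le_trans (ts _))// lerMn2r.
pose c := MkEsum (@in_Esum _ (fun i => a i - b 0%N i) (as_ 0%N)).
pose l : S := c + b 0%N.
have lE i : l i = a i by rewrite /= subrK.
have lb n : `|l - b n| <= q n *+ 8.
  apply: le_trans (ts n); apply: Esum_norm_le => i.
  by rewrite Esum_funB lE.
apply/cvg_ex; exists l; apply/cvg_ballP => e /geometric_small[n].
rewrite -/(q n) => ne; apply: filterS (Fb n) => y; rewrite -!ball_normE /=.
move=> by_; rewrite (le_lt_trans (ler_distD (b n) _ _))// (le_lt_trans _ ne)//.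
rewrite -[16%N]/(8 + 8)%N mulrnDr lerD// (le_trans (ltW by_))//.
by rewrite -[leLHS]mulr1n ler_wpMn2l// ltW.
Qed.

HB.instance Definition _ := Uniform_isComplete.Build S Esum_complete.

Lemma Esum_mulA : associative Esum_mul.
Proof. by move=> a b c; apply: Esum_eq => i /=; rewrite bmulA. Qed.
Lemma Esum_mulDl : left_distributive Esum_mul +%R.
Proof. by move=> a b c; apply: Esum_eq => i /=; rewrite bmulDl. Qed.
Lemma Esum_mulDr : right_distributive Esum_mul +%R.
Proof. by move=> a b c; apply: Esum_eq => i /=; rewrite bmulDr. Qed.
Lemma Esum_mulZl (k : C) a b : Esum_mul (k *: a) b = k *: Esum_mul a b.
Proof. by apply: Esum_eq => i /=; rewrite bmulZl. Qed.
Lemma Esum_mulZr (k : C) a b : Esum_mul a (k *: b) = k *: Esum_mul a b.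
Proof. by apply: Esum_eq => i /=; rewrite bmulZr. Qed.
Lemma norm_Esum_mul a b : `|Esum_mul a b| <= `|a| * `|b|.
Proof.
rewrite (le_trans (@Esum_norm_le (Esum_mul a b) _ (Esum_mul_le a b)))//.
by rewrite normrZ normr_id.
Qed.

HB.instance Definition _ := CompleteNormedModule_isBanachAlgebra.Build C S
  Esum_mulA Esum_mulDl Esum_mulDr Esum_mulZl Esum_mulZr norm_Esum_mul.

Lemma rnorm_Esum a : rnorm a = sl_norm E (fun i => `|a i|).
Proof. by []. Qed.

Lemma Esum_mulE a b i : (a ** b) i = a i ** b i.
Proof. by []. Qed.

End Esum_theory.

(* Main.v *)
Require Import Defs.
From mathcomp Require Import all_boot all_order all_algebra.
From mathcomp Require Import complex ring lra.
From mathcomp Require Import all_classical all_reals all_analysis.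

Import Order.TTheory GRing.Theory Num.Theory.
Import numFieldNormedType.Exports.

Local Open Scope classical_set_scope.
Local Open Scope ring_scope.

(* For a finite F in J let a be a family of unit vectors supported on F.
   If |a - a e| < d then |e_i| >= 1 - d for all i in F, so that
   (1 - d) |chi_F| <= |e| by solidity; this bounds |chi_F| by the bound of a
   right approximate identity.

   If A is amenable, no approximate identity has to be extracted from the
   virtual diagonal M.  Put Phi = pi**(M), let phi_i be a functional on A_i of
   norm at most 1 with phi_i(a_i) = |a_i|, and lambda a functional on E of norm
   at most 1 with lambda(chi_F) = |chi_F|.  For g(b) = lambda((phi_i(b_i))_i)
   the functional b |-> g(a b) still has norm at most 1, and Phi sends it to
   g(a) = |chi_F|; hence |chi_F| <= |Phi|.

   The norming functionals come from the Hahn-Banach theorem, in the form: a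
   pointwise minimal sublinear functional is linear. *)

(** * Sublinear functionals and the real Hahn-Banach theorem *)

Section sublinear_theory.
Set Implicit Arguments.
Unset Strict Implicit.
Local Open Scope complex_scope.
Context {R : realType} {V : normedModType R[i]}.
Implicit Types (x y : V) (p q : V -> R) (t : R).

(** [V] is treated as a real space. The one-sided homogeneity passes easily to infima; applied to
    [t^-1] as well, it yields equality. *)
Definition sublinear p :=
  (forall x y, p (x + y) <= p x + p y) /\
  (forall t x, 0 < t -> p (t%:C *: x) <= t * p x).

Lemma sublinearZ p t x : sublinear p -> 0 < t -> p (t%:C *: x) = t * p x.
Proof.
move=> [_ pZ] t0; apply/le_anti; rewrite pZ//= -ler_pdivlMl//.
rewrite -[X in p X <= _](scale1r x).
have -> : 1 = (t^-1)%:C * t%:C :> R[i].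
  by rewrite -rmorphM mulVf ?rmorph1// gt_eqF.
by rewrite -scalerA pZ// invr_gt0.
Qed.

Lemma sublinear0 p : sublinear p -> p 0 = 0.
Proof. by move=> /sublinearZ-/(_ _ 0 (ltr0Sn R 1)); rewrite scaler0; lra. Qed.

Lemma sublinear_geN p x : sublinear p -> - p (- x) <= p x.
Proof.
by move=> pS; have := pS.1 x (- x); rewrite subrr sublinear0//; lra.
Qed.

Lemma rnorm_sublinear : sublinear (@rnorm R V).
Proof.
split=> [x y|t x t0]; first exact: ler_rnormD.
by rewrite rnormZ ger0_norm// lecR ltW.
Qed.

(** The witness [k] may depend on the points, which covers both the family defining
    [sublinear_shift] and chains. *)
Lemma sublinear_inf (S : set (V -> R)) : S !=set0 ->
  (forall x, has_lbound [set g x | g in S]) ->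
  (forall g h x y, S g -> S h -> exists2 k, S k & k (x + y) <= g x + h y) ->
  (forall t g x, 0 < t -> S g -> exists2 k, S k & k (t%:C *: x) <= t * g x) ->
  sublinear (fun x => inf [set g x | g in S]).
Proof.
move=> [g0 Sg0] lb SD SZ.
have infS_le k x : S k -> inf [set g x | g in S] <= k x.
  by move=> Sk; apply: ge_inf => //; exists k.
have inf_geS c x : (forall g, S g -> c <= g x) -> c <= inf [set g x | g in S].
  by move=> cS; apply: lb_le_inf; [exists (g0 x), g0 | move=> _ [g /cS ? <-]].
split=> [x y|t x t0].
- rewrite -lerBlDl; apply: (inf_geS _ _) => h Sh; rewrite lerBlDl -lerBlDr.
  apply: (inf_geS _ _) => g Sg; rewrite lerBlDr.
  by have [k Sk] := SD g h x y Sg Sh; apply: le_trans; exact: infS_le.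
- rewrite -ler_pdivrMl//; apply: (inf_geS _ _) => g Sg; rewrite ler_pdivrMl//.
  by have [k Sk] := SZ t g x t0 Sg; apply: le_trans; exact: infS_le.
Qed.

(* The largest sublinear functional below [p] whose value at [- y] is at most
   [- p y]. *)
Definition sublinear_shift p y x : R :=
  inf [set g x | g in
    [set g | exists2 t, 0 <= t & g = fun z => p (z + t%:C *: y) - t * p y]].

Section shift.
Variables (p : V -> R) (y : V) (pS : sublinear p).

(** Subadditivity bounds [p (t y)] by [p (x + t y) + p (- x)]. The bound is free of [t], so the
    infimum defining the shift is finite. *)
Let shift_ge t x : 0 <= t -> - p (- x) <= p (x + t%:C *: y) - t * p y.
Proof.
rewrite le_eqVlt => /predU1P[<-|t0].
  by rewrite scale0r addr0 mul0r subr0 sublinear_geN.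
have := pS.1 (x + t%:C *: y) (- x).
by rewrite addrAC subrr add0r sublinearZ//; lra.
Qed.

Let shift_lb x : has_lbound [set g x | g in
    [set g | exists2 t, 0 <= t & g = fun z => p (z + t%:C *: y) - t * p y]].
Proof.
exists (- p (- x)) => _ [_ [t t0 ->] <-]; exact: shift_ge.
Qed.

Lemma sublinear_shift_le t x : 0 <= t ->
  sublinear_shift p y x <= p (x + t%:C *: y) - t * p y.
Proof.
move=> t0; apply: ge_inf => //.
by exists (fun z => p (z + t%:C *: y) - t * p y) => //; exists t.
Qed.

Lemma sublinear_shift_sublinear : sublinear (sublinear_shift p y).
Proof.
apply: sublinear_inf => //.
- by exists (fun z => p (z + 0%:C *: y) - 0 * p y), 0.
- move=> _ _ u v [s s0 ->] [t t0 ->].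
  exists (fun z => p (z + (s + t)%:C *: y) - (s + t) * p y).
    by exists (s + t) => //; exact: addr_ge0.
  rewrite rmorphD/= scalerDl addrACA mulrDl.
  by have := pS.1 (u + s%:C *: y) (v + t%:C *: y); lra.
- move=> t _ u t0 [s s0 ->].
  exists (fun z => p (z + (t * s)%:C *: y) - (t * s) * p y).
    by exists (t * s) => //; rewrite mulr_ge0// ltW.
  by rewrite rmorphM/= -scalerA -scalerDr sublinearZ// mulrBr mulrA.
Qed.

End shift.

(** The shift of [p] by [y] lies below [p], hence equals [p]; its member with [t = 1] then gives
    [p x <= p (x + y) - p y]. *)
Lemma minimal_sublinear_additive p : sublinear p ->
  (forall q, sublinear q -> (forall x, q x <= p x) -> q = p) ->
  forall x y, p (x + y) = p x + p y.
Proof.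
move=> pS pmin x y; apply/le_anti; rewrite pS.1/=.
have pE : sublinear_shift p y = p.
  apply: pmin; first exact: sublinear_shift_sublinear.
  move=> z; apply: le_trans (sublinear_shift_le y pS z (lexx 0)) _.
  by rewrite scale0r addr0 mul0r subr0.
have := sublinear_shift_le y pS x ler01.
by rewrite pE scale1r mul1r lerBrDr.
Qed.

(** Zorn's lemma for the reversed pointwise order; a chain is bounded by its pointwise infimum. *)
Lemma exists_minimal_sublinear q : sublinear q -> exists p,
  [/\ sublinear p, forall x, p x <= q x &
      forall r, sublinear r -> (forall x, r x <= p x) -> r = p].
Proof.
move=> qS; pose P p := sublinear p /\ forall x, p x <= q x.
pose T := {p | P p}.
pose le (p r : T) := `[< forall x, sval r x <= sval p x >].
have qT : sublinear q /\ forall x, q x <= q x by split.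
have [|p1 p2 p3 /asboolP le12 /asboolP le23||A Atot|p pmax] := @Zorn T le.
- by move=> p; apply/asboolP.
- by apply/asboolP => x; exact: le_trans (le23 x) (le12 x).
- move=> [p1 p1P] [p2 p2P] /asboolP/= le12 /asboolP/= le21.
  apply: eq_exist; apply/funext => x; apply/le_anti.
  by rewrite le12 le21.
(* Adding [q] makes the family non-empty even for an empty chain. *)
- pose S := [set g | g = q \/ exists2 p : T, A p & g = sval p].
  have SP g : S g -> sublinear g /\ forall x, g x <= q x.
    by move=> [->//|[[p pP] _ ->]].
  have lb x : has_lbound [set g x | g in S].
    exists (- q (- x)) => _ [g /SP[gS gq] <-].
    by apply: le_trans (sublinear_geN _ gS); rewrite lerN2.
  have Smin g h : S g -> S h ->
      exists2 k, S k & forall x, k x <= g x /\ k x <= h x.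
    move=> Sg Sh; have [[gS gq] [hS hq]] := (SP _ Sg, SP _ Sh).
    case: (Sg) => [->|[g' Ag' gE]]; first by exists h.
    case: (Sh) => [->|[h' Ah' hE]]; first by exists g.
    have [/asboolP|/asboolP] := Atot _ _ Ag' Ah'; rewrite -gE -hE => gh.
      by exists h.
    by exists g.
  have infS : sublinear (fun x => inf [set g x | g in S]).
    apply: sublinear_inf => //; first by exists q; left.
    - move=> g h x y Sg Sh; have [k Sk kle] := Smin g h Sg Sh.
      exists k => //; apply: le_trans ((SP _ Sk).1.1 _ _) _.
      by apply: lerD; [exact: (kle x).1|exact: (kle y).2].
    - by move=> t g x t0 Sg; exists g => //; exact: (SP _ Sg).1.2.
  have inf_le g x : S g -> inf [set g x | g in S] <= g x.
    by move=> Sg; apply: ge_inf => //; exists g.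
  have infP : sublinear (fun x => inf [set g x | g in S]) /\
      forall x, inf [set g x | g in S] <= q x.
    by split=> // x; apply: inf_le; left.
  exists (exist P _ infP) => p Ap; apply/asboolP => x /=.
  by apply: inf_le; right; exists p.
- exists (sval p); have [pS pq] := svalP p; split=> // r rS rp.
  have rP : sublinear r /\ forall x, r x <= q x.
    by split=> // x; exact: le_trans (rp x) (pq x).
  rewrite -[LHS]/(sval (exist P r rP)) -(pmax (exist P r rP))//.
  exact/asboolP.
Qed.

Lemma additive_sublinearZ p t x : sublinear p ->
  (forall x y, p (x + y) = p x + p y) -> p (t%:C *: x) = t * p x.
Proof.
move=> pS pD; have pN z : p (- z) = - p z.
  by apply/eqP; rewrite -addr_eq0 -pD addNr sublinear0.
case: (ltrgtP t 0) => [t0|t0|->]; last 2 first.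
- exact: sublinearZ.
- by rewrite scale0r mul0r sublinear0.
rewrite -[in LHS](opprK t) rmorphN/= scaleNr pN sublinearZ ?oppr_gt0//.
by rewrite mulNr opprK.
Qed.

Lemma real_hahn_banach (x0 : V) : exists p : V -> R,
  [/\ forall x y, p (x + y) = p x + p y,
      forall t x, p (t%:C *: x) = t * p x,
      forall x, p x <= rnorm x & p x0 = rnorm x0].
Proof.
(* Minimality is taken below the shift of the norm by [x0]: this shift is at most [- rnorm x0] at
   [- x0], which forces [p x0 >= rnorm x0]. *)
have nS := rnorm_sublinear.
have [p [pS pq pmin]] :=
  exists_minimal_sublinear (sublinear_shift_sublinear x0 nS).
have pD := minimal_sublinear_additive pS pmin.
exists p; split=> //.
- by move=> t x; exact: additive_sublinearZ.
- move=> x; apply: le_trans (pq x) _.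
  apply: le_trans (sublinear_shift_le x0 nS x (lexx 0)) _.
  by rewrite scale0r addr0 mul0r subr0.
- apply/le_anti/andP; split.
    apply: le_trans (pq x0) _.
    apply: le_trans (sublinear_shift_le x0 nS x0 (lexx 0)) _.
    by rewrite scale0r addr0 mul0r subr0.
  have := le_trans (pq (- x0)) (sublinear_shift_le x0 nS (- x0) ler01).
  have := pD x0 (- x0); rewrite subrr scale1r addNr rnorm0 sublinear0//; lra.
Qed.

(** * Norming functionals on a complex space *)

Lemma norming_functional (x0 : V) : exists f : dual V,
  (forall x, rnorm (f x) <= rnorm x) /\ f x0 = `|x0|.
Proof.
have [p [pD pZ pn px0]] := real_hahn_banach x0.
(* The complex-linear functional with real part [p]. *)
pose f x : R[i] := p x -i* p ('i *: x).
have pZC (k : R[i]) x :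
    p (k *: x) = complex.Re k * p x + complex.Im k * p ('i *: x).
  rewrite [k in LHS]complexE scalerDl pD pZ; congr (_ + _).
  by rewrite mulrC -scalerA pZ.
have p_i k x y : p ('i *: (k *: x + y)) =
    complex.Re k * p ('i *: x) - complex.Im k * p x + p ('i *: y).
  rewrite scalerDr pD scalerA pZC; case: k => a b /=.
  by congr (_ + _); ring.
have f_lin k x y : f (k *: x + y) = k * f x + f y.
  rewrite /f p_i pD pZC; case: k => a b /=.
  by apply/eqP; rewrite eq_complex /=; apply/andP; split; apply/eqP; ring.
have f0 : f 0 = 0.
  by have := f_lin (-1) 0 0; rewrite scaler0 addr0 mulN1r addNr.
have fZ k x : f (k *: x) = k * f x.
  by rewrite -[k *: x]addr0 f_lin f0 addr0.
have fn x : rnorm (f x : R[i]^o) <= rnorm x.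
  have [->|z0] := eqVneq (f x) 0; first by rewrite rnorm0 rnorm_ge0.
  (* Rotation by the unimodular [k] makes [f (k x) = |f x|] real, hence equal to [p (k x)]. *)
  pose k := `|f x| / f x.
  have k1 : `|k| = 1 by rewrite normrM normr_id normfV mulfV// normr_eq0.
  have := pn (k *: x); rewrite rnormZ k1 mul1r; apply: le_trans.
  by rewrite -[p _]/(complex.Re (f (k *: x))) fZ /k divfK.
have f_bl : bounded_linear (f : V -> R[i]^o).
  by split; [exact: f_lin|exists 1 => x; rewrite mul1r].
exists (Blin f_bl); split=> //=; rewrite -[RHS]rnormE -px0.
have := fn x0; rewrite -px0 /rnorm normc_def /= => sqrt_le.
(* The real part of [f x0] already has the full size [rnorm x0], so no room is left for an imaginary
   part. *)
have Im0 : p ('i *: x0) ^+ 2 <= 0.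
  have := sqr_sqrtr (addr_ge0 (sqr_ge0 (p x0)) (sqr_ge0 (- p ('i *: x0)))).
  have : Num.sqrt (p x0 ^+ 2 + (- p ('i *: x0)) ^+ 2) ^+ 2 <= p x0 ^+ 2.
    by rewrite ler_sqr// nnegrE ?sqrtr_ge0// px0 rnorm_ge0.
  by rewrite sqrrN; lra.
have /eqP := le_anti (introT andP (conj Im0 (sqr_ge0 _))).
by rewrite sqrf_eq0 /f => /eqP ->; rewrite oppr0.
Qed.
End sublinear_theory.

(** * Characteristic functions in [E] and in its restrictions *)

Section indicators.
Set Implicit Arguments.
Unset Strict Implicit.
Local Open Scope complex_scope.
Context {R : realType} {I : Type} (E : seqLattice R I).
Implicit Types (x : E) (F : set I) (f : I -> R[i]).

Lemma sl_norm_le x f :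
  (forall i, `|f i| <= `|sl_fun x i|) -> sl_norm E f <= rnorm x.
Proof. by move=> /sl_elem_le[_]; rewrite rnorm_le. Qed.

Lemma in_sl_indic F : finite_set F -> in_sl E \1_F.
Proof.
move=> Ffin; apply: sl_c00; apply: sub_finite_set Ffin => i /=.
by rewrite indicE; case: (boolP (i \in F)) => [/set_mem//|]; rewrite eqxx.
Qed.

(** Extension by zero attains the infimum: by solidity, any other extension has at least its
    norm. *)
Lemma sl_restr_norm_indic (J : set I) (G : set J) : finite_set G ->
  sl_restr_norm E \1_G = sl_norm E \1_(val @` G).
Proof.
move=> Gfin; have GE (j : J) : \1_(val @` G) (val j) = \1_G j :> R[i].
  rewrite !indicE; congr (_%:R); congr nat_of_bool; apply/idP/idP.
    by move=> /set_mem[k Gk /val_inj <-]; apply/mem_set.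
  by move=> /set_mem Gj; apply/mem_set; exists j.
have GsE := sl_elemK (in_sl_indic (finite_image val Gfin)).
apply/le_anti/andP; split.
  apply: ge_inf; first by exists 0 => _ [x _ <-]; exact: rnorm_ge0.
  by exists (sl_elem E \1_(val @` G)) => //= j; rewrite GsE GE.
apply: lb_le_inf.
  exists (sl_norm E \1_(val @` G)), (sl_elem E \1_(val @` G)) => //= j.
  by rewrite GsE GE.
move=> _ [x /= xG <-]; apply: sl_norm_le => i.
rewrite [\1__ i]indicE; case: (boolP (i \in _)) => [/set_mem[j Gj <-]|_].
  by rewrite xG -GE indicE mem_set//; exists j.
by rewrite normr0.
Qed.

Lemma lattice_const_restr (J : set I) :
  lattice_const (sl_restr_norm E (J := J)) =
  ereal_sup [set (sl_norm E \1_F)%:E | F in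
    [set F : set I | F `<=` J /\ finite_set F]].
Proof.
congr ereal_sup; apply/seteqP; split=> [_ [G /= Gfin <-]|_ [F /= [FJ Ffin] <-]].
  exists (val @` G); last by rewrite sl_restr_norm_indic.
  by split; [move=> _ [j _ <-]; exact/set_mem/valP|exact: finite_image].
have Gfin : finite_set ((val : J -> I) @^-1` F).
  by apply: finite_preimage => // j k _ _; exact: val_inj.
exists (val @^-1` F) => //; rewrite sl_restr_norm_indic//.
congr (sl_norm E \1__)%:E; apply/seteqP; split=> [_ [j Fj <-]//|i Fi].
by exists (SigSub (mem_set (FJ i Fi))).
Qed.

(** * Bounds on the norm of a characteristic function from the algebra *)

Context (A : I -> banachAlgType R[i]).
Local Notation S := (Esum E A).

Lemma exists_unit_section F : finite_set F ->
  F `<=` [set j | exists x : A j, x <> 0] ->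
  exists a : S, forall i, `|a i| = \1_F i.
Proof.
move=> Ffin FJ.
have ex i : exists x : A i, `|x| = \1_F i.
  rewrite indicE; case: (boolP (i \in F)) => [/set_mem/FJ[x /eqP x0]|_].
    by exists (`|x|^-1 *: x); rewrite normrZ normfV normr_id mulVf ?normr_eq0.
  by exists 0; rewrite normr0.
pose u i := sval (cid (ex i)).
have uE i : `|u i| = \1_F i := svalP (cid (ex i)).
have uS : in_sl E (fun i => `|u i|).
  by rewrite (_ : (fun _ => _) = \1_F); [exact: in_sl_indic|exact/funext].
by exists (MkEsum uS).
Qed.

Lemma sl_norm_indic_le_approx_id F (D : Type) (le : D -> D -> Prop)
    (e : D -> S) (c : R) :
  finite_set F -> F `<=` [set j | exists x : A j, x <> 0] ->
  bounded_right_approx_id le e -> (forall d, rnorm (e d) <= c) ->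
  sl_norm E \1_F <= c.
Proof.
move=> Ffin FJ [[[d1] lexx_ _ _] _ eP] ec; set N := sl_norm E \1_F.
have [a aE] := exists_unit_section Ffin FJ.
have key (delta : R) : 0 < delta -> delta < 1 -> (1 - delta) * N <= c.
  move=> delta0 delta1; have [d /(_ d (lexx_ d)) ad] := eP a delta delta0.
  apply: le_trans (ec d); have delta1' : 0 < 1 - delta by rewrite subr_gt0.
  have cE : (((1 - delta)^-1)%:C : R[i]) = `|((1 - delta)^-1)%:C|.
    by rewrite ger0_norm// lecR invr_ge0 ltW.
  rewrite -ler_pdivlMl//.
  have -> : (1 - delta)^-1 * rnorm (e d) =
      rnorm (((1 - delta)^-1)%:C *: Esum_norm_elem (e d)).
    by rewrite rnormZ -cE.
  (* By solidity it suffices to compare coordinates: [1 - delta <= |e_i|] on [F], nothing to prove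
     off [F]. *)
  apply: sl_norm_le => i; rewrite sl_funZ Esum_norm_elemE normrM normr_id -cE.
  rewrite -[\1_F i]aE normr_id -(rnormE (a i)) -(rnormE (e d i)).
  rewrite -rmorphM lecR/=.
  have [iF|iF] := boolP (i \in F); last first.
    suff -> : rnorm (a i) = 0 by rewrite mulr_ge0 ?rnorm_ge0// invr_ge0 ltW.
    by rewrite /rnorm aE indicE (negbTE iF).
  have a1 : rnorm (a i) = 1 by rewrite /rnorm aE indicE iF.
  rewrite ler_pdivlMl// a1 mulr1 lerBlDl -a1.
  have aeE : a i = (a - a ** e d) i + a i ** e d i.
    by rewrite Esum_funB Esum_mulE subrK.
  rewrite [X in rnorm X]aeE; apply: le_trans (ler_rnormD _ _) _; apply: lerD.
    apply: le_trans (ltW ad); rewrite -lecR !rnormE; exact: norm_Esum_fun.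
  by apply: le_trans (rnorm_bmul _ _) _; rewrite a1 mul1r.
have c0 : 0 <= c by apply: le_trans (ec d1); exact: rnorm_ge0.
rewrite leNgt; apply/negP => cN.
have N0 : 0 < N by exact: le_lt_trans cN.
(* For this [delta], [key] reads [(N + c) / 2 <= c], contrary to [c < N]; [delta < 1] follows from
   [c >= 0]. *)
have := key ((N - c) / (2 * N)); rewrite divr_gt0 ?subr_gt0 ?mulr_gt0//.
have -> : (1 - (N - c) / (2 * N)) * N = (N + c) / 2.
  by field; rewrite gt_eqF.
rewrite ltr_pdivrMr ?mulr_gt0// => /(_ isT); lra.
Qed.

Lemma sl_norm_indic_le_amenable : amenable S ->
  exists K : R, forall F, finite_set F ->
    F `<=` [set j | exists x : A j, x <> 0] -> sl_norm E \1_F <= K.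
Proof.
(* The constant is fixed before [F], whereas [a], [phi] and [lam] below depend on [F]. *)
move=> [T [M Mvd]]; exists (op_norm (biadjoint (pt_mul T) M)) => F Ffin FJ.
have [a aE] := exists_unit_section Ffin FJ.
have [_ Ma _] := Mvd a.
pose phi i : dual (A i) := sval (cid (norming_functional (a i))).
have phi_le i (x : A i) : `|phi i x| <= `|x|.
  rewrite -(rnormE (phi i x)) -(rnormE x) lecR.
  exact: (svalP (cid (norming_functional (a i)))).1.
have phi_a i : phi i (a i) = \1_F i.
  by rewrite -aE; exact: (svalP (cid (norming_functional (a i)))).2.
have [lam [lam_le lamF]] := norming_functional (sl_elem E \1_F).
pose L (b : S) : E := sl_elem E (fun i => phi i (b i)).
(* Used twice: with [c = b] for the boundedness of [L], and with the product [a ** b] against [b]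
   for the norm of [b |-> g (a b)]. *)
have Lle (b c : S) :
    (forall i, `|phi i (b i)| <= `|c i|) -> rnorm (L b) <= rnorm c.
  move=> bc; rewrite rnorm_le; apply: (@sl_elem_le _ _ E _ _ _).2 => i.
  by rewrite Esum_norm_elemE normr_id.
have Lfun (b : S) i : sl_fun (L b) i = phi i (b i).
  rewrite sl_elemK//; apply: (@sl_elem_le _ _ E _ (Esum_norm_elem b) _).1 => j.
  by rewrite Esum_norm_elemE normr_id.
have Llin : linear L.
  move=> k b c; apply: (@sl_fun_inj _ _ E _ _); apply/funext => i.
  by rewrite sl_fun_linear !Lfun /= blinD blinZ.
have Lbl : bounded_linear L.
  by split=> //; exists 1 => b; rewrite mul1r; apply: Lle.
pose g : dual S := adjoint (Blin Lbl) lam.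
have gaE : g a = (sl_norm E \1_F)%:C.
  rewrite rnormE -lamF /=; congr (lam _); congr sl_elem.
  exact/funext.
have : op_norm (adjoint (lmul a) g) <= 1.
  apply: op_norm_le => // b; rewrite mul1r /=.
  apply: le_trans (lam_le _) _; apply: Lle => i /=.
  apply: le_trans (phi_le _ _) _; apply: le_trans (normr_bmul _ _) _.
  by rewrite ler_piMl// aE indicE; case: (i \in F); rewrite ?ler01.
set Phi := biadjoint (pt_mul T) M => h1.
(* The virtual diagonal identity [a . Phi = a] in the bidual, evaluated at [g]. *)
have Phig : Phi (adjoint (lmul a) g) = (sl_norm E \1_F)%:C.
  by rewrite -gaE -[RHS]/(bidual_embed a g) -Ma.
have := rnorm_blin Phi (adjoint (lmul a) g).
rewrite Phig {1}/rnorm ger0_norm ?lecR ?rnorm_ge0//= => /le_trans; apply.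
by rewrite ler_piMr// op_norm_ge0.
Qed.
End indicators.

(** * Passage to the suprema over finite sets *)

Local Open Scope ereal_scope.

Theorem proposition4p3 (R : realType) (I : Type) (hI : inhabited I)
    (E : seqLattice R I) (A : I -> banachAlgType R[i])
    (J : set I) (hJ : J = [set j | exists x : A j, x <> 0%R]) :
  (forall (D : Type) (le : D -> D -> Prop) (e : D -> Esum E A),
    bounded_right_approx_id le e ->
    let M := ereal_sup (range (fun d => (rnorm (e d))%:E)) in
    [/\ ereal_sup [set (sl_norm E \1_F)%:E | F in
            [set F : set I | F `<=` J /\ finite_set F]]
          = lattice_const (sl_restr_norm E (J := J)),
        lattice_const (sl_restr_norm E (J := J)) <= M,
        M < +oo
      & (forall i, exists x : A i, x <> 0%R) ->
          lattice_const (sl_norm E) <= M])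
  /\
  (amenable (Esum E A) ->
    lattice_const (sl_restr_norm E (J := J)) < +oo /\
    ((forall i, exists x : A i, x <> 0%R) ->
      lattice_const (sl_norm E) < +oo)).
Proof.
have restr_le (c : R) :
    (forall F, finite_set F -> F `<=` J -> (sl_norm E \1_F <= c)%R) ->
    lattice_const (sl_restr_norm E (J := J)) <= c%:E.
  move=> Nc; rewrite lattice_const_restr.
  by apply: ge_ereal_sup => _ [F [FJ Ffin] <-]; rewrite lee_fin Nc.
have full_le (c : R) : (forall i, exists x : A i, x <> 0%R) ->
    (forall F, finite_set F -> F `<=` J -> (sl_norm E \1_F <= c)%R) ->
    lattice_const (sl_norm E) <= c%:E.
  move=> A0 Nc; apply: ge_ereal_sup => _ [F Ffin <-]; rewrite lee_fin Nc//.
  by rewrite hJ => i _; exact: A0.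
split=> [D le e eP M|/sl_norm_indic_le_amenable[K KP]].
- have [[[d0] _ _ _] [C eC] _] := eP.
  have MC : M <= C%:E by apply: ge_ereal_sup => _ [d _ <-]; rewrite lee_fin.
  have eM d : (rnorm (e d))%:E <= M by apply: ereal_sup_ubound; exists d.
  (* The index [d0] supplied by directedness excludes [-oo], the bound [C] excludes [+oo]. *)
  have Mfin : M \is a fin_num.
    rewrite fin_numE; apply/andP; split.
      by rewrite gt_eqF// (lt_le_trans _ (eM d0))// ltNyr.
    by rewrite lt_eqF// (le_lt_trans MC)// ltry.
  have NM F : finite_set F -> F `<=` J -> (sl_norm E \1_F <= fine M)%R.
    rewrite hJ => Ffin FJ; apply: sl_norm_indic_le_approx_id Ffin FJ eP _ => d.
    by rewrite -lee_fin fineK.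
  rewrite lattice_const_restr -(fineK Mfin); split=> //.
  + by rewrite -lattice_const_restr; exact: restr_le.
  + exact: ltry.
  + by move=> A0; exact: full_le.
- rewrite -hJ in KP.
  split=> [|A0]; apply: (@le_lt_trans _ _ K%:E); rewrite ?ltry//.
    exact: restr_le.
  exact: full_le.
Qed.
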